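(* Let $d,k,r\ge 2$ be integers. Every family of $k$-sets with VC-dimension at most $d$ and cardinality at least $2^{10k(dr)^{2\log^* k}}$ contains an $r$-sunflower. That is, $f^d_r(k)\le 2^{10k(dr)^{2\log^* k}}$.
   Context: A $k$-set is a set with exactly $k$ elements. A family is a collection of pairwise distinct sets. An $r$-sunflower is a collection of $r$ distinct sets $S_1,\ldots,S_r$ such that $S_i\cap S_j=S_{i'}\cap S_{j'}$ for all $i\ne j$ and $i'\ne j'$. The VC-dimension of a family $\mathcal{F}$ of subsets of a ground set $V$ is the maximum $d$ for which there is a $d$-element set $S\subset V$ such that for every $B\subset S$ there is $A\in\mathcal{F}$ with $A\cap S=B$. $f^d_r(k)$ denotes the least positive integer $m$ such that every family $\mathcal{F}$ of $k$-sets with $|\mathcal{F}|\ge m$ and VC-dimension at most $d$ contains an $r$-sunflower. All logarithms are base $2$. $\log^* k$ is the minimum positive integer $i$ for which the $i$ times iterated logarithm satisfies $\log^{(i)}k\le 2$. The exponent is $10k\cdot(dr)^{2\log^*k}$. *)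

(* Defs.v *)
From HB Require Import structures.
From mathcomp Require Import all_boot all_order all_algebra.
From mathcomp Require Import boolp classical_sets functions cardinality.
From mathcomp Require Import reals exp.
From mathcomp Require Import ring lra.

Set Implicit Arguments.
Unset Strict Implicit.
Unset Printing Implicit Defensive.

Import Order.TTheory GRing.Theory Num.Theory.

Local Open Scope classical_set_scope.
Local Open Scope card_scope.

(* The ground set is the whole type T. Families are sets of subsets of T, so
   their members are pairwise distinct; they are not required to be finite. *)

Definition k_uniform (T : Type) (k : nat) (F : set (set T)) : Prop :=
  forall A, F A -> A #= `I_k.

Definition shatters (T : Type) (F : set (set T)) (S : set T) : Prop :=
  forall B, B `<=` S -> exists2 A, F A & A `&` S = B.

Definition is_vc_dim (T : Type) (F : set (set T)) (e : nat) : Prop :=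
  (exists2 S : set T, S #= `I_e & shatters F S) /\
  (forall (n : nat) (S : set T), S #= `I_n -> shatters F S -> (n <= e)%N).

(* The empty family shatters nothing, so the maximum defining its VC-dimension
   does not exist and it does not satisfy this predicate. Below, only families
   of positive cardinality are concerned. *)
Definition vc_dim_at_most (T : Type) (F : set (set T)) (d : nat) : Prop :=
  exists2 e, is_vc_dim F e & (e <= d)%N.

Definition is_sunflower (T : Type) (r : nat) (S : 'I_r -> set T) : Prop :=
  injective S /\
  forall i j i' j' : 'I_r, i != j -> i' != j' -> S i `&` S j = S i' `&` S j'.

Definition contains_sunflower (T : Type) (r : nat) (F : set (set T)) : Prop :=
  exists2 S : 'I_r -> set T, is_sunflower S & forall i, F (S i).

Definition forces_sunflower (d r k m : nat) : Prop :=
  forall (T : Type) (F : set (set T)),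
    k_uniform k F -> vc_dim_at_most F d -> `I_m #<= F -> contains_sunflower r F.

(* The graph of f: is_sunflower_number d r k m says m = f^d_r(k). *)
Definition is_sunflower_number (d r k m : nat) : Prop :=
  [/\ (0 < m)%N, forces_sunflower d r k m &
      forall m', (0 < m')%N -> forces_sunflower d r k m' -> (m <= m')%N].

Local Open Scope ring_scope.

Definition log2 {R : realType} (x : R) : R := ln x / ln 2.

Lemma log2_le_subr1 (R : realType) (x : R) : 2 <= x -> log2 x <= x - 1.
Proof.
move=> x2; have ln2_ge : 1 / 2 <= ln 2 :> R.
  have : ln (1 + - (1 / 2)) <= - (1 / 2) :> R by apply: le_ln1Dx; lra.
  have -> : 1 + - (1 / 2) = 2^-1 :> R by field.
  by rewrite lnV ?posrE//; lra.
have ln2_gt0 : 0 < ln 2 :> R by lra.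
have lnx2 : ln (x / 2) <= x / 2 - 1.
  by rewrite -{1}[x / 2](addrNK 1) addrC; apply: le_ln1Dx; lra.
rewrite ln_div ?posrE in lnx2; [|lra|lra].
rewrite /log2 ler_pdivrMr//; nra.
Qed.

Lemma log_star_subproof (R : realType) (k : nat) :
  exists i : nat, (0 < i)%N && (iter i (@log2 R) k%:R <= 2).
Proof.
suff H n (x : R) : x <= n%:R + 2 ->
    exists i : nat, (0 < i)%N && (iter i log2 x <= 2).
  by apply: (H k); rewrite lerDl.
elim: n x => [|n IH] x xn.
  exists 1%N => /=; case: (lerP x 2) => [x2|/ltW x2]; last first.
    by have := log2_le_subr1 x2; lra.
  have ln2 : 0 < ln 2 :> R by rewrite ln_gt0// ltr1n.
  rewrite /log2 ler_pdivrMr//; have [x0|x0] := lerP x 0.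
    by rewrite ln0//; lra.
  have : ln x <= ln 2 by rewrite ler_ln ?posrE.
  lra.
case: (lerP x 2) => [x2|/ltW x2].
  by apply: IH; apply: le_trans x2 _; rewrite lerDr.
have [|i /andP[i0 Hi]] := IH (log2 x).
  have := log2_le_subr1 x2; rewrite -natr1 in xn; lra.
by exists i.+1; rewrite iterSr.
Qed.

(* ln is 0 on nonpositive reals; for k >= 2 this junk value plays no role, as
   every iterate up to the minimal index is positive. *)
Definition log_star (R : realType) (k : nat) : nat :=
  ex_minn (log_star_subproof R k).

(* Main.v *)
Require Import Defs.
From mathcomp Require Import all_boot all_order all_algebra finmap.
From mathcomp Require Import boolp classical_sets functions cardinality.
From mathcomp Require Import reals exp zify.

(** Write K for 2 ^ (10 (d r) ^ (2 log* k)), so that the family F has at least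
   K ^ k members. As log* k >= 1, this K is at least 2 ^ (10 (d r) ^ 2), which
   exceeds both 2 * 9 ^ d and 2 ^ (12 r ^ 2) by a wide margin.

   Passing to a finite subfamily, choose S with |S| < k of maximal cardinality
   among the sets contained in at least K ^ (k - |S|) members, and let F_S be
   the N members containing S. By maximality F_S is spread outside S: a set S1
   disjoint from S lies in at most N / K ^ |S1| members of F_S. The key claim
   (meeting_pairs_le) is that two random members of a spread family of bounded
   VC-dimension meet with probability less than 1 / r ^ 2. Granting it, the
   graph of meeting pairs is so sparse that it has r independent vertices
   (sparse_independent); these are members of F_S whose pairwise intersections
   are exactly S, that is, an r-sunflower.

   The key claim is proved by replacing sets of size k with sets of logarithmic
   size. Call a point popular if it lies in more than N / 4 ^ j members, where
   2 ^ j is about k, and let U' be the set of popular points.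
   - A fixed member has at most k points, so that it meets another one in an
     unpopular point with probability at most k / 4 ^ j <= 2 ^ - j.
   - There are at most k 4 ^ j <= 8 ^ j popular points, hence by the
     Sauer-Shelah lemma only (8 ^ j + 1) ^ d traces on U'; a given trace with
     more than j points has probability at most K ^ - j by spreadness, so a
     trace this large occurs with probability at most 2 ^ - j.
   What remains is a spread family whose traces on U' have at most j points,
   about log k, and the same argument applies to it. The sizes fall as an
   iterated logarithm, so the errors 3 * 2 ^ - j add up to little more than the
   last one, and once the size is at most 2 ^ (12 r ^ 2) the union bound
   (size / K) finishes. *)

Set Implicit Arguments.
Unset Strict Implicit.
Unset Printing Implicit Defensive.

Section FiniteFamilies.
(* The finite-set versions of the names shared with the library of classical
   sets are the ones meant in this section. *)
Import mathcomp.boot.fintype mathcomp.boot.finset.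

(** * Traces of finite families of bounded VC-dimension *)

Definition shattered (V : finType) (F : {set {set V}}) (S : {set V}) : Prop :=
  forall B : {set V}, B \subset S -> exists2 A, A \in F & A :&: S = B.

Definition vc_le (V : finType) (F : {set {set V}}) (d : nat) : Prop :=
  forall S, shattered F S -> #|S| <= d.

Lemma vc_le_sub (V : finType) (F G : {set {set V}}) d :
  G \subset F -> vc_le F d -> vc_le G d.
Proof.
move=> /subsetP sGF vcF S shS; apply: vcF => B /shS[A AG <-].
by exists A => //; apply: sGF.
Qed.

Lemma vc_le_trace (V : finType) (F : {set {set V}}) (U : {set V}) d :
  vc_le F d -> vc_le [set A :&: U | A in F] d.
Proof.
move=> vcF S shS; apply: vcF => B /[dup] BS /shS[_ /imsetP[A AF ->] <-].
have [_ /imsetP[A' _ ->] SU] := shS S (subxx _).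
exists A => //; rewrite -setIA; congr (_ :&: _); apply/esym/setIidPr.
by rewrite -SU (subset_trans (subsetIl _ _))// subsetIr.
Qed.

Lemma leq_exp2r_weak e m n : m <= n -> m ^ e <= n ^ e.
Proof. by case: e => // e mn; rewrite leq_exp2r. Qed.

(** Weaker than the usual sum of binomial coefficients, but of the right order
   for fixed d. Splitting off a point x of U, the members are counted by their
   traces on U :\ x, those for which both A and x |: A occur being counted
   twice; the latter form a family in which every shattered set can be enlarged
   by x, so that it has smaller VC-dimension. *)
Lemma sauer_shelah (V : finType) (U : {set V}) (G : {set {set V}}) d :
  (forall A, A \in G -> A \subset U) -> vc_le G d -> #|G| <= #|U|.+1 ^ d.
Proof.
have [n leUn] := ubnP #|U|; elim: n U G d leUn => // n IHn U G d leUn GU vcG.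
have [U0|[x xU]] := set_0Vmem U.
  have : G \subset [set set0].
    by apply/subsetP=> A /GU; rewrite U0 subset0 inE.
  move=> /subset_leq_card; rewrite cards1 => /leq_trans; apply.
  by rewrite expn_gt0.
have cU : #|U| = #|U :\ x|.+1 by rewrite (cardsD1 x U) xU.
pose G1 := [set A :\ x | A in G].
pose G2 := [set A in G | (x \notin A) && (x |: A \in G)].
(* Deleting x is injective once the members A whose partner x |: A also lies
   in G have been set aside. *)
have cG : #|G| <= #|G1| + #|G2|.
  suff : #|G :\: G2| <= #|G1|.
    have := cardsID G2 G; have := subset_leq_card (subsetIr G G2); lia.
  rewrite -(@card_in_imset _ _ (fun A => A :\ x) (G :\: G2)).
    by apply/subset_leq_card/imsetS/subsetDl.
  have notx (A : {set V}) : x \notin A -> A :\ x = A.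
    by move=> xA; apply/setDidPl; rewrite disjoint_sym disjoints1.
  move=> A B; rewrite !inE => /andP[nA AG] /andP[nB BG] eAB.
  rewrite AG BG /= in nA nB.
  case: (boolP (x \in A)) nA => xA nA; case: (boolP (x \in B)) nB => xB nB.
  - by rewrite -(setD1K xA) eAB setD1K.
  - by move: nB; rewrite -(notx _ xB) -eAB/= setD1K// AG.
  - by move: nA; rewrite -(notx _ xA) eAB/= setD1K// BG.
  - by rewrite -(notx _ xA) eAB notx.
have G1U A : A \in G1 -> A \subset U :\ x.
  by case/imsetP=> B /GU BU ->; apply: setSD.
have vcG1 : vc_le G1 d.
  suff -> : G1 = [set A :&: ~: [set x] | A in G] by apply: vc_le_trace.
  by apply: eq_imset => A; rewrite setDE.
have IH1 : #|G1| <= #|U| ^ d by rewrite cU; apply: IHn => //; lia.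
have G2U A : A \in G2 -> A \subset U :\ x.
  rewrite !inE => /and3P[/GU AU xA _]; apply/subsetP => y yA.
  rewrite !inE (subsetP AU)// andbT; apply: contraNneq xA => <- //.
have vcG2 S : shattered G2 S -> #|S| < d.
  move=> shS; have xS : x \notin S.
    have [A] := shS S (subxx _); rewrite !inE => /and3P[_ xA _] SA.
    by apply: contra xA => xS; have := xS; rewrite -{1}SA inE => /andP[].
  suff /vcG : shattered G (x |: S) by rewrite cardsU1 xS.
  move=> B BS; have [|A] := shS (B :\ x).
    by rewrite subDset.
  rewrite !inE => /and3P[AG xA AxG] AS.
  case: (boolP (x \in B)) => xB.
    by exists (x |: A) => //; rewrite -setUIr AS setD1K.
  exists A => //; rewrite setIUr AS; apply/setP => y; rewrite !inE.
  by case: (eqVneq y x) => [->|_]; rewrite ?(negbTE xA) ?(negbTE xB) ?andbF.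
case: (set_0Vmem G2) => [G20|[A AG2]].
  apply: leq_trans cG _; rewrite G20 cards0 addn0.
  by rewrite (leq_trans IH1)// leq_exp2r_weak.
case: d {vcG vcG1} vcG2 IH1 => [|d] vcG2 IH1.
  have /vcG2 // : shattered G2 set0.
  by move=> B; rewrite subset0 => /eqP ->; exists A; rewrite ?setI0.
have IH2 : #|G2| <= #|U| ^ d.
  by rewrite cU; apply: IHn => [|//|S /vcG2]; [lia | rewrite ltnS].
by have := leq_exp2r_weak d (leqnSn #|U|); rewrite !expnS in IH1 *; nia.
Qed.

(** * Meeting pairs in spread families *)

Definition degree (V : finType) (F : {set {set V}}) (S : {set V}) : nat :=
  #|[set A in F | S \subset A]|.

(** Ordered pairs, the diagonal included. *)
Definition meeting_pairs (V : finType) (F : {set {set V}}) (U : {set V}) :=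
  [set p in setX F F | p.1 :&: p.2 :&: U != set0].

Lemma sum_card_setI (V : finType) (F : {set {set V}}) (W : {set V}) :
  \sum_(A in F) #|A :&: W| = \sum_(x in W) degree F [set x].
Proof.
under eq_bigr => A _ do rewrite -sum1_card.
rewrite (exchange_big_dep (mem W)) => [|A x _]/=; last first.
  by rewrite inE => /andP[].
apply: eq_bigr => x xW; rewrite /degree -sum1_card; apply: eq_bigl => A.
by rewrite !inE xW andbT sub1set.
Qed.

Lemma card_meeting_pairs (V : finType) (F : {set {set V}}) (U : {set V}) :
  #|meeting_pairs F U| = \sum_(A in F) \sum_(B in F) (A :&: B :&: U != set0).
Proof.
rewrite -sum1_card pair_big_dep /= big_mkcond [RHS]big_mkcond.
apply: eq_bigr => -[A B] _; rewrite !inE/=.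
by do 2!case: (_ \in F) => //=; case: eqP.
Qed.

(** A member meeting a given member A inside W contains one of the at most k
   points of A :&: W. *)
Lemma union_bound (V : finType) (F : {set {set V}}) (W : {set V}) c k N :
  (forall x, x \in W -> degree F [set x] * c <= N) ->
  (forall A, A \in F -> #|A :&: W| <= k) ->
  #|meeting_pairs F W| * c <= #|F| * (k * N).
Proof.
move=> degW cardF; rewrite card_meeting_pairs big_distrl -sum_nat_const/=.
apply: leq_sum => A AF.
have : \sum_(B in F) (A :&: B :&: W != set0)
    <= \sum_(B in F) #|B :&: (A :&: W)|.
  apply: leq_sum => B _; rewrite -setIA setICA.
  by case: eqP => [->|/eqP]; rewrite ?cards0// card_gt0.
move=> /leq_mul/(_ (leqnn c))/leq_trans; apply; rewrite sum_card_setI.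
rewrite big_distrl/=.
apply: leq_trans (_ : #|A :&: W| * N <= _); last first.
  by rewrite leq_mul2r cardF// orbT.
by rewrite -sum_nat_const; apply: leq_sum => x /setIP[_ /degW].
Qed.

(** Each of the few traces that the Sauer-Shelah lemma allows is, being a large
   set, contained in few members. *)
Lemma card_large_traces (V : finType) (F : {set {set V}}) (U : {set V})
    (d t K N : nat) :
  vc_le F d ->
  (forall S : {set V}, S \subset U -> degree F S * K ^ #|S| <= N) -> 0 < K ->
  #|[set A in F | t < #|A :&: U|]| * K ^ t <= #|U|.+1 ^ d * N.
Proof.
move=> vcF spF K0; set H := [set A in F | _].
have HF : H \subset F by apply/subsetP=> A; rewrite inE => /andP[].
have trH : #|[set A :&: U | A in H]| <= #|U|.+1 ^ d.
  apply: sauer_shelah; last by apply: vc_le_trace; apply: vc_le_sub vcF.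
  by move=> _ /imsetP[A _ ->]; apply: subsetIr.
apply: leq_trans (leq_mul trH (leqnn N)); rewrite -[leqRHS]sum_nat_const.
rewrite -sum1_card (partition_big_imset (fun A => A :&: U))/= big_distrl/=.
apply: leq_sum => _ /imsetP[A AH ->].
apply: leq_trans (spF (A :&: U) (subsetIr _ _)).
apply: leq_mul; last first.
  by rewrite leq_pexp2l//; move: AH; rewrite inE => /andP[_ /ltnW].
rewrite sum1dep_card; apply/subset_leq_card/subsetP => B.
rewrite !inE => /andP[/andP[-> _]/= /eqP <-]; exact: subsetIl.
Qed.

(** Past this threshold the old size, about 2 ^ n, outweighs the new size n by
   the constants that the logarithmic step costs. *)
Lemma exp2_dominates D n : 12 * D < n -> 4 < n ->
  12 * D * n.+1 <= 2 ^ n /\ n * 4 <= 2 ^ n.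
Proof.
move=> Dn n4; suff : n * n.+1 <= 2 ^ n by nia.
rewrite -(subnK n4); elim: (n - 5) => [|m IH] //.
by rewrite addSn expnS; move: (2 ^ _) IH => a; nia.
Qed.

(** The numerical part of one logarithmic step: the P meeting pairs among k-sets
   are P' pairs among j-sets, Q pairs meeting in an unpopular point, and those
   with one of the e members of large trace as a component; a stands for 2 ^ j
   and b for 2 ^ j.-1. The difference between the factors k / k.+1 and j / j.+1
   pays for the errors. *)
Lemma recursion_arith (N P P' Q e b a k j D : nat) :
  P <= P' + Q + 2 * (e * N) -> j.+1 * D * P' <= j * N ^ 2 ->
  Q * a <= N ^ 2 -> e * a <= N -> a = 2 * b -> k <= a -> b < k ->
  12 * D * j.+1 <= a -> j * 4 <= a -> 0 < a ->
  k.+1 * D * P <= k * N ^ 2.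
Proof.
move=> PE P'E QE eE aE ka bk Dj j4 aa.
have a0 : 0 < a * j.+1 by rewrite muln_gt0 aa.
rewrite -(leq_pmul2r a0).
have eE2 : 2 * (e * N) * a <= 2 * N ^ 2.
  by rewrite -mulnA leq_mul// mulnAC -mulnn leq_mul.
have step1 : P * (a * (D * j.+1)) <= (a * j + 3 * (D * j.+1)) * N ^ 2.
  apply: leq_trans (leq_mul PE (leqnn _)) _.
  have h1 : P' * (a * (D * j.+1)) <= a * j * N ^ 2.
    have := leq_mul (leqnn a) P'E; nia.
  have h2 : (Q + 2 * (e * N)) * (a * (D * j.+1)) <= 3 * (D * j.+1) * N ^ 2.
    have := leq_mul (leq_add QE eE2) (leqnn (D * j.+1)); nia.
  rewrite -addnA mulnDl [leqRHS]mulnDl; exact: leq_add.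
have step2 : k.+1 * (a * j + 3 * (D * j.+1)) <= k * (a * j.+1).
  have t1 : 3 * (k.+1 * (D * j.+1)) * 2 <= k * a.
    have := leq_mul (leqnn k.+1) Dj; nia.
  have t2 : (a * j) * 2 <= k * a by nia.
  nia.
have := leq_mul (leqnn k.+1) step1; have := leq_mul step2 (leqnn (N ^ 2)).
move: (N ^ 2) (a * j + _) => N2 Z; nia.
Qed.

(** The logarithmic step, iterated: unpopular points and large traces account for
   few pairs, and the other pairs meet in the popular points, on which traces
   are small. Spreadness is measured against a fixed N >= #|F|, so that passing
   to a subfamily and to a smaller U preserves the hypotheses. The factor
   k / k.+1, which increases with k, leaves room in the induction for the pairs
   discarded when k is replaced by its logarithm. *)
Lemma meeting_pairs_le (V : finType) (d D K : nat) (hD : 3 < D)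
    (hK : (2 ^ (12 * D)).+1 * D <= K) (hKd : 2 * 9 ^ d <= K) (N k : nat)
    (F : {set {set V}}) (U : {set V}) :
  vc_le F d -> (forall A, A \in F -> #|A :&: U| <= k) -> #|F| <= N ->
  (forall S : {set V}, S \subset U -> degree F S * K ^ #|S| <= N) ->
  k.+1 * D * #|meeting_pairs F U| <= k * N ^ 2.
Proof.
have [n] := ubnP k; elim: n => // n IHn in k F U * => kn vcF cardF FN spF.
have K0 : 0 < K by apply: leq_trans hKd; rewrite muln_gt0 expn_gt0.
(* Small sets: the union bound over single points suffices. *)
have [kb|kb] := leqP k (2 ^ (12 * D)).
  have : #|meeting_pairs F U| * K <= #|F| * (k * N).
    apply: union_bound => // x xU; rewrite -[K]expn1 -(cards1 x).
    by apply: spF; rewrite sub1set.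
  move=> h.
  have : k.+1 * D * #|meeting_pairs F U| <= K * #|meeting_pairs F U|.
    apply: leq_mul => //; apply: leq_trans hK; apply: leq_mul => //.
  move=> /leq_trans; apply.
  rewrite mulnC (leq_trans h)// -mulnn mulnCA; apply: leq_mul => //.
  by apply: leq_mul.
have [F0|Fn0] := eqVneq F set0.
  rewrite (_ : meeting_pairs F U = set0) ?cards0 ?muln0//.
  by apply/setP=> -[A B]; rewrite F0 !inE.
have N0 : 0 < N by apply: leq_trans FN; rewrite card_gt0.
have k2 : 1 < k by apply: leq_trans kb; rewrite ltnS expn_gt0.
set j := up_log 2 k.
have /andP[jk kj] := up_log_bounds (isT : 1 < 2) k2; rewrite -/j in jk kj.
have jb : 12 * D < j by rewrite -(ltn_exp2l _ _ (isT : 1 < 2)) (leq_trans kb).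
have [Dj j4] := exp2_dominates jb ltac:(lia).
have j2 : 2 ^ j = 2 * 2 ^ j.-1 by rewrite -expnS prednK//; lia.
(* The popular points. *)
pose U' := [set x in U | N < degree F [set x] * 4 ^ j].
have U'U : U' \subset U by apply/subsetP=> x; rewrite inE => /andP[].
have cardU' : #|U'| <= 8 ^ j.
  rewrite -(leq_pmul2r N0).
  have : #|U'| * N <= \sum_(x in U') degree F [set x] * 4 ^ j.
    rewrite -sum_nat_const; apply: leq_sum => x; rewrite inE => /andP[_].
    exact: ltnW.
  move=> /leq_trans; apply; rewrite -big_distrl -sum_card_setI/=.
  have : \sum_(A in F) #|A :&: U'| <= #|F| * k.
    rewrite -sum_nat_const; apply: leq_sum => A AF.
    apply: leq_trans (cardF A AF); apply: subset_leq_card; exact: setIS.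
  move=> h; rewrite (_ : 8 = 2 * 4)// expnMn mulnAC leq_mul// (leq_trans h)//.
  by rewrite mulnC leq_mul.
pose F' := [set A in F | #|A :&: U'| <= j].
pose E := [set A in F | j < #|A :&: U'|].
have F'F : F' \subset F by apply/subsetP=> x; rewrite inE => /andP[].
have small_pairs : j.+1 * D * #|meeting_pairs F' U'| <= j * N ^ 2.
  apply: IHn.
  - lia.
  - exact: vc_le_sub vcF.
  - by move=> A; rewrite inE => /andP[].
  - exact: leq_trans (subset_leq_card F'F) FN.
  - move=> S SU'; apply: leq_trans (spF S (subset_trans SU' U'U)).
    apply: leq_mul => //; apply/subset_leq_card/subsetP => A.
    by rewrite !inE => /andP[/andP[-> _]].
have rare_pairs : #|meeting_pairs F (U :\: U')| * 2 ^ j <= N ^ 2.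
  have : #|meeting_pairs F (U :\: U')| * 4 ^ j <= #|F| * (k * N).
    apply: union_bound => [x|A AF].
      by rewrite !inE => /andP[+ xU]; rewrite xU/= -leqNgt.
    apply: leq_trans (cardF A AF); apply/subset_leq_card/setIS/subsetDl.
  rewrite (_ : 4 = 2 * 2)// expnMn mulnA => h.
  rewrite -(leq_pmul2r (_ : 0 < 2 ^ j)) ?expn_gt0//.
  apply: leq_trans h _; rewrite mulnCA mulnC -mulnn; apply: leq_mul => //.
  exact: leq_mul.
have cardE : #|E| * 2 ^ j <= N.
  have spU' (S : {set V}) : S \subset U' -> degree F S * K ^ #|S| <= N.
    by move=> SU'; apply: spF; apply: subset_trans U'U.
  have := card_large_traces j vcF spU' K0; rewrite -/E => h.
  have : 2 ^ j * #|U'|.+1 ^ d <= K ^ j.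
    apply: leq_trans (_ : (2 * 9 ^ d) ^ j <= _); last first.
      by rewrite leq_exp2r//; lia.
    rewrite expnMn leq_mul// -expnM mulnC expnM leq_exp2r_weak//.
    rewrite (leq_ltn_trans cardU')//.
    by rewrite ltn_exp2r//; lia.
  move=> h2; have h3 : #|E| * (2 ^ j * #|U'|.+1 ^ d) <= #|U'|.+1 ^ d * N.
    by apply: leq_trans h; rewrite leq_mul.
  rewrite -(leq_pmul2r (_ : 0 < #|U'|.+1 ^ d)) ?expn_gt0// -mulnA.
  by rewrite [leqRHS]mulnC.
have split_pairs : #|meeting_pairs F U| <=
       #|meeting_pairs F' U'| + #|meeting_pairs F (U :\: U')| + 2 * (#|E| * N).
  have : meeting_pairs F U \subset meeting_pairs F' U'
      :|: meeting_pairs F (U :\: U') :|: (setX E F :|: setX F E).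
    apply/subsetP => -[A B]; rewrite !inE/= => /andP[/andP[AF BF]] ABU.
    rewrite AF BF/= !andbT.
    have [Aj|Aj] := leqP #|A :&: U'| j; rewrite ?orbT//=.
    have [Bj|Bj] := leqP #|B :&: U'| j; rewrite ?orbT//=.
    rewrite orbF -negb_and; apply: contra ABU => /andP[/eqP h1 /eqP h2].
    by rewrite -(setID U U') (setIidPr U'U) setIUr h1 h2 setU0.
  move=> /subset_leq_card/leq_trans; apply.
  apply: leq_trans (leq_card_setU _ _) _; apply: leq_add.
    exact: leq_card_setU.
  apply: leq_trans (leq_card_setU _ _) _; rewrite !cardsX mulnC.
  have := leq_mul (leqnn #|E|) FN; lia.
apply: (recursion_arith split_pairs small_pairs rare_pairs cardE j2) => //.
by rewrite expn_gt0.
Qed.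

(** * Sunflowers in finite families *)

(** Greedily: a vertex of least degree has few neighbours, and deleting them
   keeps the remaining graph sparse enough for one vertex less. Nothing forbids
   repetitions in s unless e is reflexive on X. *)
Lemma sparse_independent (T : finType) (e : rel T) (r : nat) (X : {set T}) :
  symmetric e ->
  #|[set p in setX X X | e p.1 p.2]| * r ^ 2 < #|X| ^ 2 ->
  exists2 s : seq T, size s = r &
    all [in X] s /\ pairwise (fun x y => ~~ e x y) s.
Proof.
move=> syme; elim: r X => [|r IHr] X; first by exists [::].
set P := [set p in _ | _] => sparse.
have [x0 x0X] : exists x, x \in X.
  by apply/set0Pn; rewrite -card_gt0; case: #|X| sparse => //; rewrite exp0n.
pose nbr x := [set y in X | e x y].
pose x := [arg min_(x < x0 in X) #|nbr x|].
have [xX minx] : x \in X /\ forall y, y \in X -> #|nbr x| <= #|nbr y|.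
  by rewrite /x; case: arg_minnP.
have cardP : #|X| * #|nbr x| <= #|P|.
  have -> : #|P| = \sum_(y in X) #|nbr y|.
    under [RHS]eq_bigr => y _ do rewrite -sum1_card.
    rewrite pair_big_dep -sum1_card/=; apply: eq_bigl => -[y z].
    by rewrite !inE/= andbA.
  by rewrite -sum_nat_const; apply: leq_sum.
pose X' := [set y in X | ~~ e x y].
have cardX' : #|X| = #|nbr x| + #|X'|.
  rewrite -(cardsID [set y | e x y] X); congr (_ + _); apply: eq_card => y.
    by rewrite !inE.
  by rewrite !inE andbC.
have [|s <- [sX' ps]] := IHr X'.
  have : #|[set p in setX X' X' | e p.1 p.2]| <= #|P|.
    apply/subset_leq_card/subsetP=> -[y z]; rewrite !inE/=.
    by move=> /andP[/andP[/andP[-> _] /andP[-> _]] ->].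
  move: sparse cardP cardX'; move: #|P| #|X| #|nbr x| #|X'| #|_| => p n g n' p'.
  move=> sparse cardP cardX' p'p.
  have n0 : 0 < n by nia.
  have g1 : g * r.+1 ^ 2 < n.
    rewrite -(ltn_pmul2l n0) mulnA mulnn; apply: leq_ltn_trans sparse.
    exact: leq_mul.
  have n'r : n * r <= n' * r.+1 by rewrite -mulnn in g1; nia.
  have n'0 : 0 < n' by rewrite -mulnn in g1; nia.
  case: r {IHr} sparse g1 n'r => [|r] sparse g1 n'r.
    by rewrite muln0 expn_gt0 n'0.
  rewrite -(ltn_pmul2r (_ : 0 < r.+2 ^ 2)) ?expn_gt0//.
  apply: leq_trans (_ : n ^ 2 * r.+1 ^ 2 <= _); last first.
    by rewrite -!expnMn leq_exp2r.
  rewrite mulnAC ltn_pmul2r ?expn_gt0// (leq_ltn_trans _ sparse)//.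
  exact: leq_mul.
exists (x :: s) => //=; rewrite xX ps andbT/=.
split; apply/allP => y /(allP sX'); rewrite inE => /andP[] //.
Qed.

(** The kernel is a largest set S, among those with fewer than k points, that lies
   in at least K ^ (k - |S|) members: by maximality the members containing S are
   spread outside S. *)
Lemma finite_sunflower (V : finType) (d k r K : nat) (F : {set {set V}})
    (hr : 1 < r) (hk : 0 < k)
    (hK : (2 ^ (12 * r ^ 2)).+1 * r ^ 2 <= K) (hKd : 2 * 9 ^ d <= K) :
  (forall A, A \in F -> #|A| = k) -> vc_le F d -> K ^ k <= #|F| ->
  exists2 f : 'I_r -> {set V}, injective f /\ (forall i, f i \in F) &
    exists C, forall i j, i != j -> f i :&: f j = C.
Proof.
move=> unifF vcF largeF.
have K0 : 0 < K by apply: leq_trans hKd; rewrite muln_gt0 expn_gt0.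
(* Requiring #|S| < k makes the members proper supersets of S, so that the
   petals A :\: S are nonempty and disjoint petals are distinct. *)
pose heavy (S : {set V}) := (#|S| < k) && (K ^ (k - #|S|) <= degree F S).
have heavy0 : heavy set0.
  rewrite /heavy cards0 hk subn0/= (leq_trans largeF)//.
  by apply/subset_leq_card/subsetP => A AF; rewrite inE AF sub0set.
have [S /andP[Sk Sdeg] maxS] : exists2 S, heavy S &
    forall S', heavy S' -> #|S'| <= #|S|.
  by case: (arg_maxnP (fun S : {set V} => #|S|) heavy0) => S; exists S.
pose FS := [set A in F | S \subset A].
have FSF : FS \subset F by apply/subsetP => A; rewrite inE => /andP[].
have FS0 : 0 < #|FS| by apply: leq_trans Sdeg; rewrite expn_gt0 K0.
have meetS A : A \in FS -> #|A :&: ~: S| = k - #|S|.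
  rewrite inE => /andP[AF SA]; rewrite -setDE cardsD (setIidPr SA).
  by rewrite unifF.
have spread (S1 : {set V}) :
    S1 \subset ~: S -> degree FS S1 * K ^ #|S1| <= #|FS|.
  move=> S1S.
  have degE : degree FS S1 = degree F (S :|: S1).
    by apply: eq_card => A; rewrite !inE subUset andbA.
  have cardS : #|S :|: S1| = #|S| + #|S1|.
    rewrite cardsU (_ : S :&: S1 = set0) ?cards0 ?subn0//.
    by apply/eqP; rewrite setIC setI_eq0 disjoints_subset.
  have [S10|S10] := posnP #|S1|.
    rewrite S10 muln1 degE /degree; apply/subset_leq_card/subsetP => A.
    by rewrite !inE subUset => /andP[-> /andP[->]].
  apply: leq_trans Sdeg; rewrite degE.
  have [lt_k|ge_k] := ltnP #|S :|: S1| k.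
    have : ~~ heavy (S :|: S1).
      by apply: contraL S10 => /maxS; rewrite cardS; lia.
    rewrite /heavy lt_k/= -ltnNge => /ltnW h.
    apply: leq_trans (leq_mul h (leqnn _)) _.
    by rewrite -expnD leq_pexp2l//; lia.
  (* Here maximality says nothing: k-sets containing a k-set coincide. *)
  have [F0|/set0Pn[A]] := eqVneq [set A in F | S :|: S1 \subset A] set0.
    by rewrite /degree F0 cards0.
  rewrite inE => /andP[AF SA].
  have cA : #|S :|: S1| = k.
    by apply/eqP; rewrite eqn_leq ge_k andbT -(unifF A AF) subset_leq_card.
  have -> : k - #|S| = #|S1| by lia.
  rewrite -[leqRHS]mul1n leq_mul// /degree -(cards1 A).
  apply/subset_leq_card/subsetP => B; rewrite !inE => /andP[BF SB].
  have toA C : C \in F -> S :|: S1 \subset C -> S :|: S1 = C.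
    by move=> CF SC; apply/eqP; rewrite eqEcard SC unifF// cA leqnn.
  by rewrite -(toA A)// (toA B).
pose e (A B : {set V}) := A :&: B :&: ~: S != set0.
have [||s ss [sF ps]] := @sparse_independent _ e r FS.
- by move=> A B; rewrite /e (setIC A).
- have hD : 3 < r ^ 2 by rewrite -mulnn; nia.
  have h : k.+1 * r ^ 2 * #|meeting_pairs FS (~: S)| <= k * #|FS| ^ 2.
    apply: (meeting_pairs_le hD hK hKd) => //; first exact: vc_le_sub vcF.
    by move=> A AF; rewrite meetS// leq_subr.
  have N0 : 0 < #|FS| ^ 2 by rewrite expn_gt0 FS0.
  rewrite -(ltn_pmul2l (_ : 0 < k.+1))// [_ * r ^ 2]mulnC mulnA.
  by rewrite (leq_ltn_trans h)// ltn_pmul2r.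
have nthF (i : 'I_r) : nth set0 s i \in FS.
  by apply: (allP sF); rewrite mem_nth// ss.
have disj (i j : 'I_r) :
    i != j -> nth set0 s i :&: nth set0 s j :&: ~: S = set0.
  wlog ij : i j / i < j.
    move=> h; have [/h//|ji|/val_inj->] := ltngtP i j; last by rewrite eqxx.
    by rewrite eq_sym setIC (setIC (nth _ _ i)) setIC; apply: h.
  move=> _; have /(pairwiseP set0)/(_ i j) := ps.
  by rewrite !inE ss => /(_ (ltn_ord _) (ltn_ord _) ij); rewrite negbK => /eqP.
exists (fun i => nth set0 s i); first split.
- move=> i j eij; apply: contraTeq (nthF i) => /disj; rewrite -eij setIid => h.
  by apply: contraTN Sk => /meetS; rewrite h cards0; lia.
- by move=> i; apply: (subsetP FSF).
exists S => i j /disj ij; apply/eqP; rewrite eqEsubset subsetI.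
apply/andP; split.
  by rewrite -[S]setCK -disjoints_subset -setI_eq0 ij.
by move: (nthF i) (nthF j); rewrite !inE => /andP[_ ->] /andP[_ ->].
Qed.

End FiniteFamilies.

(** * Families over an arbitrary ground set *)

Local Open Scope classical_set_scope.
Local Open Scope card_scope.
Local Open Scope nat_scope.

Lemma card_eq_finset (V : finType) (B : {set V}) : [set` B] #= `I_#|B|.
Proof.
have -> : [set` B] = [set` [fset x in B]%fset].
  by apply/seteqP; split => x /=; rewrite inE.
by apply/card_eq_fsetP; rewrite card_finset.
Qed.

Lemma card_eq_II m n : `I_m #= `I_n -> m = n.
Proof.
by rewrite card_eq_le !card_le_II => mn; apply/eqP; rewrite eqn_leq.
Qed.

Section Lift.
(** A finite list s covering all the sets involved turns sets over T into finite
   sets over seq_sub s, and back. *)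
Variables (T : choiceType) (s : seq T).

Definition lift_set (B : {set seq_sub s}) : set T := val @` [set` B].

Definition restrict_set (A : set T) : {set seq_sub s} :=
  [set x | `[< A (val x) >]]%SET.

Lemma lift_setK : cancel lift_set restrict_set.
Proof.
move=> B; apply/setP => x; rewrite inE.
apply/asboolP/idP => [[y By /val_inj <-//]|xB].
by exists x.
Qed.

Lemma restrict_setK (A : set T) :
  A `<=` [set` s] -> lift_set (restrict_set A) = A.
Proof.
move=> As; apply/seteqP; split => [_ [x xA <-]|x Ax].
  by move: xA; rewrite /= inE => /asboolP.
by exists (SeqSub (As x Ax)) => //=; rewrite inE; apply/asboolP.
Qed.

Lemma card_lift_set B : lift_set B #= `I_#|B|.
Proof.
apply: card_eq_trans (card_eq_finset B); apply: inj_card_eq => x y _ _.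
exact: val_inj.
Qed.

Lemma lift_setI B C : lift_set (B :&: C) = lift_set B `&` lift_set C.
Proof.
apply/seteqP; split => [_ [x + <-]|_ [[x xB <-] [y yC /val_inj xy]]] /=.
  by move=> /setIP[xB xC]; split; exists x.
by exists x => //=; apply/setIP; rewrite -{2}xy.
Qed.

Lemma lift_sub B : lift_set B `<=` [set` s].
Proof. by move=> _ [x _ <-] /=; apply: valP. Qed.

End Lift.

Lemma finite_ground (T : choiceType) (k m : nat) (g : nat -> set T) :
  (forall i, i < m -> g i #= `I_k) ->
  exists s : seq T, forall i, i < m -> g i `<=` [set` s].
Proof.
move=> gk; have : finite_set (\bigcup_(i in `I_m) g i).
  apply: bigcup_finite => [|i im]; first exact: finite_II.
  by exists k; apply: gk.
move=> /finite_seqP[s Es]; exists s => i im; rewrite -Es.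
exact: bigcup_sup.
Qed.

Lemma sunflower_of_card (T : choiceType) (F : set (set T)) (d k r K : nat)
    (hr : 1 < r) (hk : 0 < k)
    (hK : (2 ^ (12 * r ^ 2)).+1 * r ^ 2 <= K) (hKd : 2 * 9 ^ d <= K) :
  k_uniform k F -> vc_dim_at_most F d -> `I_(K ^ k) #<= F ->
  contains_sunflower r F.
Proof.
move=> unifF [e [_ vcF] ed] /pcard_leP/injfunPex[g gF g_inj].
set m := K ^ k in gF g_inj.
have [s gs] := finite_ground (fun i im => unifF _ (gF i im)).
pose G := [set restrict_set s (g i) | i : 'I_m]%SET.
have liftG A : A \in G -> F (lift_set A).
  case/imsetP => i _ ->; rewrite restrict_setK; last exact/gs/ltn_ord.
  exact/gF/ltn_ord.
have [f [f_inj fG] [C fC]] : exists2 f : 'I_r -> {set seq_sub s},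
    injective f /\ (forall i, f i \in G) &
    exists C, forall i j, i != j -> f i :&: f j = C.
  apply: (finite_sunflower hr hk hK hKd).
  - move=> A /liftG/unifF AG; apply: card_eq_II; apply: card_eq_trans AG.
    by rewrite card_eq_sym; apply: card_lift_set.
  - move=> S shS; apply: leq_trans ed; apply: (vcF _ (lift_set S)).
      exact: card_lift_set.
    move=> B BS; have [|A AG AS] := shS (restrict_set s B).
      apply/fintype.subsetP => x; rewrite inE => /asboolP /BS[y yS /val_inj <-].
      exact: yS.
    exists (lift_set A); first exact: liftG.
    rewrite -lift_setI AS restrict_setK//.
    by apply: subset_trans BS _; apply: lift_sub.
  - rewrite card_imset ?card_ord// => i j eij; apply: val_inj.
    apply: g_inj; rewrite ?inE//=.
    by rewrite -(restrict_setK (gs i _))// eij restrict_setK//; exact/gs.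
exists (fun i => lift_set (f i)); last by move=> i; apply: liftG.
split; first by move=> i j /(can_inj (@lift_setK _ _))/f_inj.
by move=> i j i' j' ij ij'; rewrite -!lift_setI (fC _ _ ij) (fC _ _ ij').
Qed.

Lemma forces_sunflower_pow (d k r K : nat)
    (hr : 1 < r) (hk : 0 < k)
    (hK : (2 ^ (12 * r ^ 2)).+1 * r ^ 2 <= K) (hKd : 2 * 9 ^ d <= K) :
  forces_sunflower d r k (K ^ k).
Proof.
move=> T F; exact: (@sunflower_of_card {classic T}).
Qed.

Lemma sunflower_number_exists d r k m : 0 < m -> forces_sunflower d r k m ->
  exists2 m', is_sunflower_number d r k m' & m' <= m.
Proof.
move=> m0 fm; pose P n := (0 < n) && `[< forces_sunflower d r k n >].
have exP : exists n, P n by exists m; rewrite /P m0; apply/asboolP.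
case: (ex_minnP exP) => n /andP[n0 /asboolP fn] minn; exists n.
  by split=> // n' n'0 fn'; apply: minn; rewrite /P n'0; apply/asboolP.
by apply: minn; rewrite /P m0; apply/asboolP.
Qed.

Theorem theorem1p3 (R : realType) (d k r : nat)
    (hd : 2 <= d) (hk : 2 <= k) (hr : 2 <= r) :
  (forall (T : Type) (F : set (set T)),
     k_uniform k F -> vc_dim_at_most F d ->
     `I_(2 ^ (10 * k * (d * r) ^ (2 * log_star R k))) #<= F ->
     contains_sunflower r F) /\
  (exists2 m : nat, is_sunflower_number d r k m &
     m <= 2 ^ (10 * k * (d * r) ^ (2 * log_star R k))).
Proof.
set m := 2 ^ _.
suff fm : forces_sunflower d r k m.
  split; first exact: fm.
  by apply: sunflower_number_exists => //; rewrite expn_gt0.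
have L0 : 0 < log_star R k by rewrite /log_star; case: ex_minnP => i /andP[].
pose M := (d * r) ^ (2 * log_star R k).
have -> : m = (2 ^ (10 * M)) ^ k by rewrite -expnM mulnAC.
have M_ge : (d * r) ^ 2 <= M by rewrite leq_pexp2l//; nia.
have exp9 : 2 * 9 ^ d <= 2 ^ (1 + 4 * d).
  by rewrite expnD leq_mul// expnM leq_exp2r_weak.
have expr : r ^ 2 <= 2 ^ (r ^ 2) by apply/ltnW/ltn_expl.
have dr : (d * r) ^ 2 = d ^ 2 * r ^ 2 by rewrite expnMn.
apply: forces_sunflower_pow => //; first by lia.
  apply: leq_trans (_ : 2 ^ (1 + 12 * r ^ 2) * 2 ^ (r ^ 2) <= _).
    rewrite leq_mul// expnD expn1 mul2n -addnn.
    by have := expn_gt0 2 (12 * r ^ 2); lia.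
  rewrite -expnD leq_exp2l//.
  have : 4 * r ^ 2 <= M.
    apply: leq_trans M_ge; rewrite dr leq_mul//.
    by rewrite (leq_exp2r 2 d (isT : 0 < 2)).
  have : 4 <= r ^ 2 by rewrite (leq_exp2r 2 r (isT : 0 < 2)).
  lia.
apply: leq_trans exp9 _; rewrite leq_exp2l//.
have : d * d * 1 <= M.
  by apply: leq_trans M_ge; rewrite dr mulnn leq_mul// expn_gt0; lia.
nia.
Qed.
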